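(* Let $G$ be a finite group. Then for every $x \in G$, the integer $|C_G(x)|$ divides $|Sol_G(x)|$.
   Context: For a finite group $G$ and $x \in G$, the solvabilizer of $x$ in $G$ is the subset $Sol_G(x) = \{g \in G \mid \langle g, x\rangle \text{ is solvable}\}$ (not necessarily a subgroup). $C_G(x)$ denotes the centralizer of $x$ in $G$. *)

(* Defs.v *)
From mathcomp Require Import all_boot all_fingroup all_solvable.

Set Implicit Arguments.
Unset Strict Implicit.
Unset Printing Implicit Defensive.

Local Open Scope group_scope.

(* In general a subset of G, not a subgroup. *)
Definition solvabilizer (gT : finGroupType) (G : {set gT}) (x : gT) : {set gT} :=
  [set g in G | solvable <<[set g; x]>>].

(* Main.v *)
Require Import Defs.
From mathcomp Require Import all_boot all_fingroup all_solvable.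

Local Open Scope group_scope.

(** Whether [<g, x>] is solvable depends only on the conjugates [x ^ (g ^+ i)]:
    they generate a normal subgroup [N] of [<g, x>] with cyclic quotient
    ([solvable_gen2_class]).  Multiplying [g] on the right by an element of
    [C_G(N)] changes none of these conjugates ([conj_expg_mul_cent]), so the
    coset [g C_G(N)] lies in the solvabilizer as soon as [g] does; as all the
    elements of this coset have the same [N], such cosets partition the
    solvabilizer ([card_solvabilizer]).

    The centralizer [C_G(x)] permutes these cosets by conjugation.  An element
    of it that stabilizes [g C_G(N)] preserves the sequence of conjugates term
    by term, hence centralizes [N]; conversely [C_G(N)] stabilizes [g C_G(N)]
    because [g] normalizes [N] ([astab1_conj_coset]).  So the orbit of
    [g C_G(N)] consists of [|C_G(x) : C_G(N)|] cosets of size [|C_G(N)|], and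
    its union has exactly [|C_G(x)|] elements ([sum_orbit_conj_coset]): the
    solvabilizer is a disjoint union of sets of that size. *)

Section ConjCosets.

Set Implicit Arguments.
Unset Strict Implicit.
Unset Printing Implicit Defensive.

Variables (gT : finGroupType) (G : {group gT}) (x : gT).
Implicit Types g h c d : gT.

(** The class [x ^: <[g]>] is the set of all conjugates [x ^ (g ^+ i)], so its
    centralizer is that of the subgroup they generate. *)
Definition conj_coset g : {set gT} := g *: 'C_G(x ^: <[g]>).

Lemma mem_conj_coset g : g \in conj_coset g.
Proof. exact: lcoset_refl. Qed.

(** By induction on [i]: conjugation by [g * d] sends [x ^ (g ^+ i)] to
    [x ^ (g ^+ i.+1)], because [d] fixes the latter. *)
Lemma conj_expg_mul_cent g d i :
  d \in 'C(x ^: <[g]>) -> x ^ ((g * d) ^+ i) = x ^ (g ^+ i).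
Proof.
move=> /centP cd; elim: i => // i IHi.
rewrite 2!expgSr 2!conjgM IHi conjgM; apply/conjg_fixP/commgP/commute_sym/cd.
by rewrite -conjgM -expgSr memJ_class ?mem_cycle.
Qed.

Lemma class_cycle_mul_cent g d :
  d \in 'C(x ^: <[g]>) -> x ^: <[g * d]> = x ^: <[g]>.
Proof.
move=> cd; apply/setP=> y; apply/imsetP/imsetP=> -[_ /cycleP[i ->] ->].
  by exists (g ^+ i); rewrite ?mem_cycle ?conj_expg_mul_cent.
by exists ((g * d) ^+ i); rewrite ?mem_cycle ?conj_expg_mul_cent.
Qed.

Lemma class_cycle_coset g h :
  h \in conj_coset g -> x ^: <[h]> = x ^: <[g]>.
Proof. by case/lcosetP=> d /setIP[_ cd] ->; apply: class_cycle_mul_cent. Qed.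

Lemma conj_cosetP g h : reflect (conj_coset h = conj_coset g) (h \in conj_coset g).
Proof.
apply: (iffP idP) => [hg | <-]; last exact: mem_conj_coset.
by rewrite {1}/conj_coset (class_cycle_coset hg); exact/lcoset_eqP.
Qed.

Lemma class_cycleJ g c : c \in 'C[x] -> x ^: <[g ^ c]> = (x ^: <[g]>) :^ c.
Proof.
move=> cc; rewrite cycleJ conjsgE class_lcoset class_rcoset.
have /cent1P cVx : c^-1 \in 'C[x] by rewrite groupV.
by rewrite (conjg_fixP _) //; apply/commgP/commute_sym.
Qed.

Lemma subcent_class_cycle g : 'C_G(x ^: <[g]>) \subset 'C_G[x].
Proof. by rewrite setIS // -cent_set1 centS // sub1set class_refl. Qed.

Lemma conj_cosetJ g c :
  c \in 'C_G[x] -> conj_coset (g ^ c) = conj_coset g :^ c.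
Proof.
case/setIP=> Gc cc; rewrite /conj_coset class_cycleJ // centJ -{1}(conjGid Gc).
by rewrite -conjIg conjsMg conjg_set1.
Qed.

(** If [c] stabilizes the coset then [x ^ (g ^+ i) = x ^ ((g ^ c) ^+ i)], and
    the right-hand side is [(x ^ (g ^+ i)) ^ c] because [c] fixes [x].
    Conversely, if [c] centralizes the class then so does [[~ g, c]], because
    [g] normalizes the class; hence [g ^ c = g * [~ g, c]] is in the coset. *)
Lemma astab1_conj_coset g : g \in G ->
  'C_('C_G[x])[conj_coset g | 'Js] = 'C_G(x ^: <[g]>).
Proof.
move=> Gg; rewrite astab1Js; apply/setP=> c.
apply/setIP/setIP=> [[Cc nAc] | [Gc cNc]].
  have [Gc cc] := setIP Cc; split=> //.
  have xc: x ^ c = x by apply/conjg_fixP/commgP/commute_sym/cent1P.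
  have gcA : g ^ c \in conj_coset g by rewrite memJ_norm ?mem_conj_coset.
  have [d /setIP[_ cd] def_gc] := lcosetP gcA.
  apply/centP=> _ /imsetP[_ /cycleP[i ->] ->].
  apply/commute_sym/commgP/conjg_fixP.
  by rewrite conjJg xc conjXg def_gc conj_expg_mul_cent.
have Nc: c \in 'C_G(x ^: <[g]>) by apply/setIP.
have Cc: c \in 'C_G[x] := subsetP (subcent_class_cycle g) c Nc.
split=> //; apply/normP; rewrite -conj_cosetJ //; apply/conj_cosetP/lcosetP.
exists [~ g, c]; last by rewrite conjg_mulR.
rewrite commgEr groupM // inE groupJ ?groupV //=.
have ng: g \in 'N('C(x ^: <[g]>)).
  by rewrite (subsetP (cent_norm _)) // (subsetP (class_norm _ _)) ?cycle_id.
by rewrite memJ_norm ?groupV.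
Qed.

(** The class generates a normal subgroup of [<<[set g; x]>>], and the quotient
    is cyclic, being generated by the image of [g]. *)
Lemma solvable_gen2_class g :
  solvable <<[set g; x]>> = solvable <<x ^: <[g]> >>.
Proof.
have nNg: <[g]> \subset 'N(<<x ^: <[g]> >>) by rewrite norms_gen ?class_norm.
have ->: <<[set g; x]>> = <<x ^: <[g]> >> <*> <[g]>.
  have gN: g \in <<x ^: <[g]> >> <*> <[g]>.
    by rewrite (subsetP (joing_subr _ _)) ?cycle_id.
  have xN: x \in <<x ^: <[g]> >> <*> <[g]>.
    by rewrite (subsetP (joing_subl _ _)) ?mem_gen ?class_refl.
  apply/eqP; rewrite eqEsubset join_subG !gen_subG subUset !sub1set gN xN /=.
  by rewrite gen_subG class_subG ?cycle_subG ?mem_gen ?set21 ?set22.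
have nsN: <<x ^: <[g]> >> <| <<x ^: <[g]> >> <*> <[g]> by rewrite normalYl.
rewrite (series_sol nsN) quotientYidl // andb_idr // => _.
by rewrite abelian_sol ?quotient_abelian ?cycle_abelian.
Qed.

Lemma solvabilizerJ g c :
  c \in 'C_G[x] -> (g ^ c \in solvabilizer G x) = (g \in solvabilizer G x).
Proof.
case/setIP=> Gc cc; rewrite !inE (groupJr _ Gc) !solvable_gen2_class class_cycleJ //.
by rewrite genJ -(isog_sol (conj_isog _ c)).
Qed.

Lemma solvabilizer_conj_coset g h :
  h \in conj_coset g -> (h \in solvabilizer G x) = (g \in solvabilizer G x).
Proof.
move=> hg; rewrite !inE !solvable_gen2_class (class_cycle_coset hg).
by case/lcosetP: hg => d /setIP[Gd _] ->; rewrite groupMr.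
Qed.

Lemma card_solvabilizer :
  #|solvabilizer G x| =
    \sum_(A in [set conj_coset g | g in solvabilizer G x]) #|A|.
Proof.
rewrite -sum1_card (partition_big_imset conj_coset) /=.
apply: eq_bigr => _ /imsetP[g Sg ->]; rewrite -sum1_card.
apply: eq_bigl => h; rewrite (sameP eqP (conj_cosetP g h)) andbC.
by apply: andb_idr => /solvabilizer_conj_coset->.
Qed.

(** The orbit sizes and the coset sizes compensate: all cosets in the orbit have
    the size of the stabilizer of any one of them. *)
Lemma sum_orbit_conj_coset g :
  g \in G ->
  \sum_(A in orbit 'Js 'C_G[x] (conj_coset g)) #|A| = #|'C_G[x]|.
Proof.
move=> Gg; rewrite (eq_bigr (fun=> #|'C_G(x ^: <[g]>)|)); last first.
  by move=> _ /orbitP[c _ <-]; rewrite /= cardJg card_lcoset.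
rewrite sum_nat_const card_orbit astab1_conj_coset // mulnC Lagrange //.
exact: subcent_class_cycle.
Qed.

End ConjCosets.

Theorem proposition2p13 (gT : finGroupType) (G : {group gT}) (x : gT)
    (xG : x \in G) : #|'C_G[x]| %| #|solvabilizer G x|.
Proof.
set P := [set conj_coset G x g | g in solvabilizer G x].
have actsP: [acts 'C_G[x], on P | 'Js].
  apply/actsP=> c Cc A /=; apply/imsetP/imsetP=> [][g Sg].
    move/(canRL (conjsgK c)) => ->; exists (g ^ c^-1).
      by rewrite solvabilizerJ ?groupV.
    by rewrite conj_cosetJ ?groupV.
  by move=> ->; exists (g ^ c); rewrite ?solvabilizerJ ?conj_cosetJ.
rewrite card_solvabilizer (set_partition_big _ (orbit_partition actsP)) /=.
apply: dvdn_sum => _ /imsetP[_ /imsetP[g /setIdP[Gg _] ->] ->].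
by rewrite sum_orbit_conj_coset.
Qed.
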